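(* Let $m\ge3$ be an integer and $n=\frac{3^m-1}{2}$. Let $\beta$ be a primitive $2n$-th root of unity in an extension field of $\mathrm{GF}(3)$ and let $\mathbb{M}_{\beta^i}(x)$ denote the minimal polynomial of $\beta^i$ over $\mathrm{GF}(3)$. Let $\mathcal{C}(m)$ be the ternary negacyclic code of length $n$ with check polynomial $\mathrm{lcm}(\mathbb{M}_\beta(x),\mathbb{M}_{\beta^{2n-1}}(x))$. Then $\mathcal{C}(m)$ has parameters $[n,2m,d]$ with $d\ge\frac{3^{m-1}-1}{2}$, and $\mathcal{C}(m)^\perp$ has parameters $[n,n-2m,5]$.
   Context: A ternary negacyclic code of length $n$ is an ideal of $\mathrm{GF}(3)[x]/(x^n+1)$; a code with check polynomial $h(x)$ (a monic divisor of $x^n+1$) is the one with generator polynomial $(x^n+1)/h(x)$. $[n,k,d]$ denotes length, dimension, minimum Hamming distance; $\perp$ is the Euclidean dual. *)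

(* Defs.v *)
From HB Require Import structures.
From mathcomp Require Import all_boot all_order all_algebra all_field.
Set Implicit Arguments. Unset Strict Implicit. Unset Printing Implicit Defensive.
Import GRing.Theory.
Local Open Scope ring_scope.

(* GF(3) is 'F_3.  An "extension field of GF(3)" is a field F together with
   a ring morphism f : 'F_3 -> F. *)

Definition is_minpoly (F : fieldType) (f : {rmorphism 'F_3 -> F}) (x : F)
    (p : {poly 'F_3}) : Prop :=
  [/\ p \is monic, root (map_poly f p) x &
      forall q : {poly 'F_3}, q != 0 -> root (map_poly f q) x -> (size p <= size q)%N].

Definition is_lcm (p q l : {poly 'F_3}) : Prop :=
  [/\ l \is monic, p %| l, q %| l &
      forall r : {poly 'F_3}, p %| r -> q %| r -> l %| r].

(* The ternary negacyclic code of length n with check polynomial h: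
   the ideal of GF(3)[x]/(x^n+1) generated by g = (x^n+1)/h, with words
   c = (c_0,...,c_{n-1}) identified with c_0 + c_1 x + ... + c_{n-1} x^{n-1}.
   Since g divides x^n+1, c lies in this ideal iff g divides c(x). *)
Definition negacyclic_code (n : nat) (h : {poly 'F_3}) : {set 'rV['F_3]_n} :=
  [set c : 'rV['F_3]_n | (('X^n + 1) %/ h) %| rVpoly c].

Definition code_dim (n : nat) (C : {set 'rV['F_3]_n}) : nat :=
  \dim <<enum C>>%VS.

Definition wt (n : nat) (c : 'rV['F_3]_n) : nat := #|[set i | c 0 i != 0]|.

Definition is_min_dist (n : nat) (C : {set 'rV['F_3]_n}) (d : nat) : Prop :=
  (exists2 c, c \in C & (c != 0) /\ wt c = d) /\
  (forall c, c \in C -> c != 0 -> (d <= wt c)%N).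

Definition dual_code (n : nat) (C : {set 'rV['F_3]_n}) : {set 'rV['F_3]_n} :=
  [set v : 'rV['F_3]_n | [forall c in C, \sum_(i < n) v 0 i * c 0 i == 0]].

(* Main.v *)
(* The roots of the check polynomial h are the 2m distinct powers beta^(3^j) and
   beta^(-3^j), so h has degree 2m.  The odd exponents strictly between 3^(m-1)
   and 2 3^(m-1) - 1 are consecutive zeros of the code, and the BCH bound gives
   the estimate on d.  As the roots of h are closed under inversion, the dual is
   the set of multiples of h.  A dual word of weight w amounts to nonzero
   y_1, ..., y_w, distinct up to sign, with sum y_i = sum 1/y_i = 0, which is
   impossible for w <= 4 in characteristic 3; and a counting argument modulo h
   produces a multiple of h of weight at most 5. *)
Require Import Defs.
From mathcomp Require Import all_boot all_order all_algebra all_field.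
From mathcomp Require Import mxabelem zify ring.
Set Implicit Arguments. Unset Strict Implicit. Unset Printing Implicit Defensive.
Import GRing.Theory.
Local Open Scope ring_scope.

(** * Frobenius and minimal polynomials over GF(3) *)

Lemma card_F3 : #|'F_3| = 3%N.
Proof. exact: card_Fp. Qed.

Lemma rmorph_F3_pchar (F : fieldType) (f : {rmorphism 'F_3 -> F}) :
  3%N \in [pchar F].
Proof. by rewrite inE /= -(rmorph_nat f) pchar_Fp_0 // rmorph0. Qed.

(** Cubing is a ring morphism in characteristic 3 and fixes the coefficients, which come from GF(3).
    Hence roots come in Frobenius orbits. *)
Lemma horner_map_F3_exp (F : fieldType) (f : {rmorphism 'F_3 -> F})
    (p : {poly 'F_3}) (x : F) (j : nat) :
  (map_poly f p).[x ^+ (3 ^ j)] = (map_poly f p).[x] ^+ (3 ^ j).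
Proof.
elim: j => [|j IHj]; first by rewrite expn0 !expr1.
rewrite expnSr !exprM -IHj; set y := x ^+ _.
rewrite -!(pFrobenius_autE (rmorph_F3_pchar f)) -horner_map -map_poly_comp.
congr (_.[_]); apply: eq_map_poly => a /=.
by rewrite pFrobenius_autE -rmorphXn /= (_ : a ^+ 3 = a) // -[RHS]expf_card card_F3.
Qed.

Lemma root_map_F3_exp (F : fieldType) (f : {rmorphism 'F_3 -> F})
    (p : {poly 'F_3}) (x : F) (j : nat) :
  root (map_poly f p) x -> root (map_poly f p) (x ^+ (3 ^ j)).
Proof.
rewrite /root horner_map_F3_exp => /eqP->.
by rewrite expr0n expn_eq0.
Qed.

Lemma dvdp_minpoly (F : fieldType) (f : {rmorphism 'F_3 -> F}) (x : F)
    (M q : {poly 'F_3}) :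
  is_minpoly f x M -> (M %| q) = root (map_poly f q) x.
Proof.
move=> [monM Mx0 minM]; apply/idP/idP => [/dvdpP[r ->]|rootq].
  by rewrite rmorphM rootM Mx0 orbT.
apply: contraT => nz; have := minM _ nz.
rewrite leqNgt ltn_modp monic_neq0 //; apply.
move: rootq; rewrite /root {1}(divp_eq q M) rmorphD rmorphM /= hornerD hornerM.
by rewrite (eqP Mx0) mulr0 add0r.
Qed.

(* Evaluation at x maps the 3^(m+1) polynomials of degree at most m to the at
   most 3^m roots of X^(3^m) - X, so it is not injective. *)
Lemma minpoly_size_le (F : fieldType) (f : {rmorphism 'F_3 -> F}) (m : nat)
    (x : F) (M : {poly 'F_3}) :
  (0 < m)%N -> x ^+ (3 ^ m) = x -> is_minpoly f x M -> (size M <= m.+1)%N.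
Proof.
move=> m0 xq [_ _ minM].
pose ev (v : 'rV['F_3]_m.+1) := (map_poly f (rVpoly v)).[x].
have [/injectiveP ev_inj|/injectivePn[u [v neq_uv eq_uv]]] :=
  boolP (injectiveb ev).
  pose P := 'X^(3 ^ m) - 'X : {poly F}.
  have szP : size P = (3 ^ m).+1.
    rewrite /P size_polyDl ?size_polyN ?size_polyXn ?size_polyX //.
    by rewrite ltnS (@ltn_exp2l 3 0).
  have := @max_poly_roots _ P [seq ev v | v <- enum 'rV['F_3]_m.+1].
  rewrite size_map -cardE szP card_mx card_F3 mul1n ltnS leqNgt.
  rewrite ltn_exp2l // ltnSn -size_poly_eq0 szP => /(_ isT) H.
  suff: false by []; apply: H; last by rewrite map_inj_uniq ?enum_uniq.
  apply/allP => _ /mapP[v _ ->].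
  by rewrite /root !hornerE /ev -horner_map_F3_exp xq subrr.
(* A collision gives a nonzero polynomial of degree at most [m] vanishing at [x], to which
   minimality applies. *)
apply: leq_trans (minM (rVpoly (u - v)) _ _) (size_poly _ _).
  by rewrite -(inj_eq (can_inj rVpolyK)) in neq_uv; rewrite linearB subr_eq0.
by rewrite /root linearB rmorphB /= !hornerE [_.[x]]eq_uv subrr.
Qed.

(** * Counting codewords; dimension and dual of a linear code *)

Lemma size_rVpoly (R : nzSemiRingType) (n : nat) (c : 'rV[R]_n) :
  (size (rVpoly c) <= n)%N.
Proof. exact: size_poly. Qed.

(** Multiplication by [g] is a bijection from cofactors of size at most [n - k] onto these words. *)
Lemma card_words_dvdp (n k : nat) (g : {poly 'F_3}) :
  size g = k.+1 -> (k <= n)%N ->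
  #|[set c : 'rV['F_3]_n | g %| rVpoly c]| = (3 ^ (n - k))%N.
Proof.
move=> szg kn.
have g0 : g != 0 by rewrite -size_poly_eq0 szg.
have sz_mul (u : 'rV['F_3]_(n - k)) : (size (rVpoly u * g)%R <= n)%N.
  have [->|u0] := eqVneq (rVpoly u) 0; first by rewrite mul0r size_poly0.
  rewrite size_mul // szg addnS /=.
  by move: (size_rVpoly u); rewrite -(leq_add2r k) subnK.
pose phi (u : 'rV['F_3]_(n - k)) : 'rV['F_3]_n := poly_rV (rVpoly u * g).
have phi_inj : injective phi.
  move=> u v /(congr1 rVpoly); rewrite !poly_rV_K // => /(mulIf g0).
  exact: (can_inj rVpolyK).
have -> : [set c : 'rV['F_3]_n | g %| rVpoly c] = [set phi u | u : 'rV_(n - k)].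
  apply/setP => c; rewrite inE; apply/idP/imsetP => [/dvdpP[q eq_c]|[u _ ->]].
    exists (poly_rV q) => //; rewrite /phi poly_rV_K -?eq_c ?rVpolyK //.
    have := size_rVpoly c; rewrite eq_c.
    have [->|q0] := eqVneq q 0; first by rewrite size_poly0.
    by rewrite size_mul // szg addnS /= => le_n; rewrite -(leq_add2r k) subnK.
  by rewrite /phi poly_rV_K // dvdp_mull.
by rewrite card_imset // card_mx card_F3 mul1n.
Qed.

Definition linear_code (n : nat) (C : {set 'rV['F_3]_n}) : Prop :=
  0 \in C /\ forall a u v, u \in C -> v \in C -> a *: u + v \in C.

Lemma linear_code_sum (n : nat) (C : {set 'rV['F_3]_n}) (I : finType)
    (a : I -> 'F_3) (u : I -> 'rV['F_3]_n) :
  linear_code C -> (forall i, u i \in C) -> \sum_i a i *: u i \in C.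
Proof.
move=> [C0 CL] uC; elim/big_rec: _ => // i x _; exact: CL.
Qed.

Lemma code_dim_card (n k : nat) (C : {set 'rV['F_3]_n}) :
  linear_code C -> #|C| = (3 ^ k)%N -> code_dim C = k.
Proof.
move=> linC cardC; apply: (@expnI 3) => //; rewrite -cardC -[in LHS]card_F3.
rewrite /code_dim -card_vspace; apply: eq_card => v; apply/idP/idP => [|vC].
  move/(@coord_span _ _ _ (in_tuple (enum C))) => ->; apply: linear_code_sum => // i.
  by rewrite -mem_enum mem_nth.
by rewrite memv_span // mem_enum.
Qed.

Lemma linear_code_dual (n : nat) (C : {set 'rV['F_3]_n}) :
  linear_code (dual_code C).
Proof.
split=> [|a u v]; rewrite !inE.
  by apply/forall_inP => c _; rewrite big1 // => i _; rewrite mxE mul0r.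
move=> /forall_inP uC /forall_inP vC; apply/forall_inP => c cC.
under eq_bigr do rewrite !mxE mulrDl -mulrA.
by rewrite big_split -mulr_sumr /= (eqP (uC c cC)) (eqP (vC c cC)) mulr0 addr0.
Qed.

(** Rank-nullity: with all codewords as the rows of [A], the dual is the kernel of the transpose,
    and counting the row space gives rank [k]. *)
Lemma card_dual_code (n k : nat) (C : {set 'rV['F_3]_n}) :
  linear_code C -> #|C| = (3 ^ k)%N -> #|dual_code C| = (3 ^ (n - k))%N.
Proof.
move=> linC cardC; pose A : 'M['F_3]_(#|C|, n) := \matrix_i enum_val i.
have rowgC : rowg A = C.
  apply/setP => v; rewrite mem_rowg; apply/idP/idP => [/submxP[D ->]|vC].
    rewrite mulmx_sum_row; apply: linear_code_sum => // i.
    by rewrite rowK enum_valP.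
  by rewrite -(enum_rankK_in vC vC) -rowK row_sub.
have rankA : \rank A = k.
  apply: (@expnI 3) => //; apply: etrans cardC.
  by have := card_rowg A; rewrite rowgC card_F3.
have -> : dual_code C = rowg (kermx A^T).
  apply/setP => v; rewrite mem_rowg sub_kermx inE.
  apply/forall_inP/eqP => [vC|vA c cC].
    apply/rowP => i; rewrite !mxE; under eq_bigr do rewrite !mxE.
    by apply/eqP/vC/enum_valP.
  move/rowP/(_ (enum_rank_in cC c)): vA; rewrite !mxE.
  by under eq_bigr do rewrite !mxE enum_rankK_in //; move->.
by rewrite card_rowg card_F3 mxrank_ker mxrank_tr rankA.
Qed.

Lemma linear_code_dvdp (n : nat) (g : {poly 'F_3}) :
  linear_code [set c : 'rV['F_3]_n | g %| rVpoly c].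
Proof.
split=> [|a u v]; rewrite !inE ?linear0 ?dvdp0 // linearP => gu gv.
by apply: dvdp_add => //=; rewrite -mul_polyC dvdp_mull.
Qed.

(** * Evaluation of words and the BCH bound *)

Lemma horner_map_rVpoly (R S : nzRingType) (f : {rmorphism R -> S}) (n : nat)
    (c : 'rV[R]_n) (x : S) :
  (map_poly f (rVpoly c)).[x] = \sum_(i < n) f (c 0 i) * x ^+ i.
Proof.
rewrite (@horner_coef_wide _ n); last first.
  by apply: leq_trans (size_rVpoly c); exact: size_poly.
by apply: eq_bigr => i _; rewrite coef_map coef_rVpoly_ord.
Qed.

Lemma row_neq0_entry (n : nat) (c : 'rV['F_3]_n) : c != 0 -> exists i, c 0 i != 0.
Proof.
move=> c0; apply/existsP; apply: contraNT c0 => /existsPn c0.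
by apply/eqP/rowP => i; rewrite mxE; apply/eqP; rewrite -[_ == _]negbK c0.
Qed.

(* The locator polynomial of the support minus one position is a combination
   of the d vanishing evaluations, yet it isolates a single entry of c. *)
Lemma BCH_bound (F : fieldType) (f : {rmorphism 'F_3 -> F}) (n d : nat)
    (c : 'rV['F_3]_n) (a z : F) :
  a != 0 -> injective (fun i : 'I_n => z ^+ i) -> c != 0 ->
  (forall k, (k < d)%N -> root (map_poly f (rVpoly c)) (a * z ^+ k)) ->
  (d < wt c)%N.
Proof.
move=> a0 z_inj /row_neq0_entry[i0 ci0] rts; rewrite ltnNge; apply/negP => le_d.
pose S := [set i | c 0 i != 0] :\ i0.
pose P := \prod_(x <- [seq z ^+ i | i : 'I_n in S]) ('X - x%:P).
have szP : (size P <= d)%N.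
  rewrite size_prod_XsubC size_map -cardE; apply: leq_trans le_d.
  by rewrite /wt [X in (_ <= X)%N](cardsD1 i0) inE ci0.
have: \sum_(i < n) f (c 0 i) * a ^+ i * P.[z ^+ i] = 0.
  under eq_bigr do rewrite (horner_coef_wide _ szP) mulr_sumr.
  rewrite exchange_big big1 //= => k _.
  have /eqP := rts k (ltn_ord k); rewrite horner_map_rVpoly => sum0.
  apply: etrans (etrans (congr1 ( *%R P`_k) sum0) (mulr0 _)).
  rewrite mulr_sumr; apply: eq_bigr => i _.
  by rewrite exprMn -!exprM mulnC; ring.
rewrite (bigD1 i0) //= big1 ?addr0 => [/eqP|i ni0].
  rewrite !mulf_eq0 fmorph_eq0 (negPf ci0) expf_eq0 (negPf a0) andbF /=.
  rewrite -[_ == 0]/(root P _) root_prod_XsubC => /imageP[i].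
  by rewrite !inE => /andP[ni0 _] /z_inj eq_i; rewrite eq_i eqxx in ni0.
have [->|ci] := eqVneq (c 0 i) 0; first by rewrite rmorph0 !mul0r.
have: root P (z ^+ i).
  by rewrite root_prod_XsubC; apply/imageP; exists i; rewrite ?inE ?ni0.
by move/eqP->; rewrite mulr0.
Qed.

Lemma min_dist_exists (n d : nat) (C : {set 'rV['F_3]_n}) :
  (1 < #|C|)%N -> (forall c, c \in C -> c != 0 -> (d <= wt c)%N) ->
  exists d', is_min_dist C d' /\ (d <= d')%N.
Proof.
move=> C1 wtC; have /card_gt0P[c0] : (0 < #|C :\ 0%R|)%N.
  by move: C1; rewrite (cardsD1 0); case: (_ \in C) => //; rewrite add0n => /ltnW.
rewrite in_setD1 => Pc0.
case: (@arg_minnP _ c0 (fun c => (c != 0) && (c \in C)) (@wt n) Pc0).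
move=> c /andP[nc cC] cmin.
exists (wt c); split; last exact: wtC.
by split=> [|c' c'C nc']; [exists c | apply: cmin; rewrite nc'].
Qed.

(** * Reciprocal polynomials, inner products, and exclusion of weights below five *)

(** This is X^n v(1/X). Reversing at [n] rather than [n - 1] makes the constant coefficient an
    out-of-range entry of [v], which is 0 by default. *)
Definition reciprocal (n : nat) (v : 'rV['F_3]_n) : {poly 'F_3} :=
  \poly_(k < n.+1) (rVpoly v)`_(n - k).

Lemma horner_reciprocal (F : fieldType) (f : {rmorphism 'F_3 -> F}) (n : nat)
    (v : 'rV['F_3]_n) (x : F) :
  x != 0 -> (map_poly f (reciprocal v)).[x] =
            x ^+ n * (map_poly f (rVpoly v)).[x^-1].
Proof.
move=> x0; rewrite (@horner_coef_wide _ n.+1); last first.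
  by rewrite size_map_poly size_poly.
rewrite (@horner_coef_wide _ n.+1 (map_poly f (rVpoly v))); last first.
  by rewrite size_map_poly ltnW // ltnS size_rVpoly.
rewrite (reindex_inj rev_ord_inj) mulr_sumr; apply: eq_bigr => i _ /=.
have le_in : (i <= n)%N by rewrite -ltnS.
rewrite subSS !coef_map coef_poly ltnS leq_subr subKn //= mulrCA.
by rewrite exprVn -expfB_cond // (negPf x0).
Qed.

(* The product u(X) X^n v(1/X) has no constant term and its coefficient of X^n
   is the inner product of u and v; modulo X^n + 1 these two coefficients are
   opposite. *)
Lemma dot_eq0 (n : nat) (u v : 'rV['F_3]_n) :
  (0 < n)%N -> 'X^n + 1 %| rVpoly u * reciprocal v ->
  \sum_(i < n) u 0 i * v 0 i = 0.
Proof.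
move=> n0 /dvdpP[w eq_uv].
have mon : 'X^n + 1 \is @monic 'F_3 by rewrite -[1]polyC1 monicXnaddC.
(* The product has size at most 2n, so [w] has no coefficient at [n]; the coefficients of w (X^n +
   1) at 0 and at [n] are then both that of [w] at 0. *)
have szw : (size w <= n)%N.
  have [->|w0] := eqVneq w 0; first by rewrite size_poly0.
  have sz : size (w * ('X^n + 1)) = (size w + n)%N.
    by rewrite size_Mmonic // -[1]polyC1 size_XnaddC // addnS.
  rewrite -(leq_add2r n) -sz -eq_uv; apply: leq_trans (size_polyMleq _ _) _.
  have szv : (size (reciprocal v) <= n.+1)%N := size_poly _ _.
  by move: (leq_add (size_rVpoly u) szv); rewrite addnS; case: (_ + _)%N.
have coefn (p : {poly 'F_3}) k : (p * ('X^n + 1))`_k =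
    (if (k < n)%N then 0 else p`_(k - n)) + p`_k.
  by rewrite mulrDr mulr1 coefD coefMXn.
have rvn (x : 'rV['F_3]_n) : (rVpoly x)`_n = 0.
  by rewrite nth_default // size_rVpoly.
have coefV k : (k <= n)%N -> (reciprocal v)`_k = (rVpoly v)`_(n - k).
  by move=> le_k; rewrite coef_poly ltnS le_k.
have w0 : w`_0 = 0.
  have := congr1 (fun p : {poly 'F_3} => p`_0) eq_uv.
  rewrite coefn n0 add0r => <-.
  by rewrite coefM big_ord1 coefV // subn0 rvn mulr0.
have := congr1 (fun p : {poly 'F_3} => p`_n) eq_uv.
rewrite coefn ltnn subnn w0 add0r [w`_n]nth_default // coefM big_ord_recr /=.
rewrite rvn mul0r addr0 => sum0; apply: etrans sum0; apply: eq_bigr => i _.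
by rewrite coefV ?leq_subr // subKn ?(ltnW (ltn_ord i)) // !coef_rVpoly_ord.
Qed.

(* With e_1 = e_3 = 0 four elements are the roots of an even polynomial, and
   with e_1 = e_2 = 0 three elements are the roots of X^3 - e_3, which is a
   cube in characteristic 3. *)
Lemma size_zero_sums (F : fieldType) (ys : seq F) :
  3%N \in [pchar F] -> ys != [::] -> 0 \notin ys ->
  uniq [seq y ^+ 2 | y <- ys] ->
  \sum_(y <- ys) y = 0 -> \sum_(y <- ys) y^-1 = 0 -> (4 < size ys)%N.
Proof.
move=> ch3; have three0 : 3%:R = 0 :> F by apply/eqP; case/andP: ch3.
case: ys => [//|a [|b [|c [|d [|//]]]]] _; rewrite !inE ?negb_or ![0 == _]eq_sym.
all: rewrite /= ?inE ?negb_or ?andbT !big_cons !big_nil !addr0.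
- by move=> a0 _ aE; rewrite aE eqxx in a0.
- move=> _ nab /eqP; rewrite addr_eq0 => /eqP ab.
  by rewrite ab sqrrN eqxx in nab.
- move=> /and3P[a0 b0 c0] /andP[/andP[nab _] _] /eqP; rewrite addr_eq0 => /eqP aE.
  move=> /(congr1 ( *%R (a * b * c))); rewrite mulr0.
  have -> : a * b * c * (a^-1 + (b^-1 + c^-1)) = b * c + a * (c + b).
    by field; rewrite a0 b0 c0.
  rewrite aE => sum0; case/eqP: nab; rewrite aE.
  (* After substituting [a = - (b + c)], the square of [b - c] is -3bc - e_2, which vanishes; then
     [b = c] and a = -2c = c. *)
  have: (b - c) ^+ 2 = 0.
    have -> : (b - c) ^+ 2 =
        3%:R * (- b * c) - (b * c + - (b + c) * (c + b)) by ring.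
    by rewrite sum0 three0; ring.
  move/eqP; rewrite expf_eq0 subr_eq0 => /eqP->.
  have -> : (- (c + c)) ^+ 2 = c ^+ 2 + 3%:R * c ^+ 2 by ring.
  by rewrite three0 mul0r addr0.
move=> /and4P[a0 b0 c0 d0] /and3P[/and3P[nab nac nad] _ _] sum1 sum2.
have dE : d = - (a + b + c).
  by apply/eqP; rewrite -addr_eq0 -sum1; apply/eqP; ring.
have: a * b * c * d * (a^-1 + (b^-1 + (c^-1 + d^-1))) = 0 by rewrite sum2 mulr0.
(* The left side is e_3. Once e_1 = 0 it factors, so [a] is the opposite of another element, against
   the distinctness of the squares. *)
have -> : a * b * c * d * (a^-1 + (b^-1 + (c^-1 + d^-1))) =
    (a + b) * (a + c) * (a + d) - a ^+ 2 * (a + b + c + d).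
  by field; rewrite a0 b0 c0 d0.
rewrite -!addrA sum1 mulr0 subr0 => /eqP; rewrite !mulf_eq0 !addr_eq0.
by case/orP => [/orP[]|] /eqP aE; move: nab nac nad; rewrite aE sqrrN eqxx ?andbF.
Qed.

Lemma F3_sqr (a : 'F_3) : a != 0 -> a ^+ 2 = 1.
Proof. by case: a => [[|[|[|]]]] // i _; apply/val_inj. Qed.

(** Nonzero entries are 1 or -1, hence their own inverses. So the terms y_i = v_i b^i have inverses
    v_i b^-i and distinct squares b^(2i), and the two roots become the two zero sums. *)
Lemma wt_ge5 (F : fieldType) (f : {rmorphism 'F_3 -> F}) (n : nat) (b : F)
    (v : 'rV['F_3]_n) :
  b != 0 -> injective (fun i : 'I_n => (b ^+ 2) ^+ i) -> v != 0 ->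
  root (map_poly f (rVpoly v)) b -> root (map_poly f (rVpoly v)) b^-1 ->
  (5 <= wt v)%N.
Proof.
move=> b0 b_inj v0; rewrite /root !horner_map_rVpoly => /eqP sum1 /eqP sum2.
pose S := [set i | v 0 i != 0]; pose y i := f (v 0 i) * b ^+ i.
have sumS (z : F) : \sum_(i in S) f (v 0 i) * z ^+ i = \sum_(i < n) f (v 0 i) * z ^+ i.
  rewrite big_mkcond; apply: eq_bigr => i _; rewrite inE.
  by have [->|//] := eqVneq; rewrite rmorph0 mul0r.
have fv2 i : i \in S -> f (v 0 i) ^+ 2 = 1.
  by rewrite inE => vi; rewrite -rmorphXn F3_sqr // rmorph1.
have -> : wt v = size [seq y i | i in S] by rewrite size_map -cardE.
apply: size_zero_sums (rmorph_F3_pchar f) _ _ _ _ _.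
- have [i vi] := row_neq0_entry v0.
  by rewrite -size_eq0 size_map -cardE cards_eq0; apply/set0Pn; exists i; rewrite inE.
- apply/imageP => -[i]; rewrite inE => vi /esym/eqP.
  by rewrite mulf_eq0 fmorph_eq0 (negPf vi) expf_eq0 (negPf b0) andbF.
- rewrite -map_comp map_inj_in_uniq ?enum_uniq // => i j.
  rewrite !mem_enum => iS jS /=; rewrite !exprMn !fv2 // !mul1r.
  by rewrite -!exprM ![(_ * 2)%N]mulnC !exprM => /b_inj.
- by rewrite big_image -[RHS]sum1 -sumS.
rewrite big_image -[RHS]sum2 -sumS; apply: eq_bigr => i iS.
rewrite /y invfM exprVn; congr (_ * _); apply: (@mulfI _ (f (v 0 i))).
  by rewrite fmorph_eq0; move: iS; rewrite inE.
by rewrite -expr2 fv2 // mulfV // fmorph_eq0; move: iS; rewrite inE.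
Qed.

(** * Sparse words and a pigeonhole for light multiples *)

Lemma card_ltn_pairs (N : nat) :
  #|[set p : 'I_N * 'I_N | (p.1 < p.2)%N]| = 'C(N, 2).
Proof.
rewrite -sum1dep_card -(pair_big_dep predT (fun i j : 'I_N => (i < j)%N) (fun _ _ => 1%N)) /=.
rewrite (exchange_big_dep predT) //= -bin2_sum big_mkord; apply: eq_bigr => j _.
rewrite sum1dep_card -[RHS](card_ord j).
have le_jN : (j <= N)%N by exact: ltnW.
rewrite -(card_image (f := widen_ord le_jN)); last first.
  by move=> x y /(congr1 val) eq_xy; apply: val_inj.
rewrite cardsE; apply: eq_card => i; apply/idP/imageP => [ij|[k _ ->]].
  by exists (Ordinal ij) => //; apply/val_inj.
exact: (ltn_ord k).
Qed.

(** The booleans encode the two nonzero scalars. Position 0 is shared by all these words, so a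
    difference of two of them touches at most five positions instead of six. *)
Definition sparse_word (N : nat) (a : 'F_3) (s t : bool) (i j : 'I_N) :
    'rV['F_3]_N.+1 :=
  \row_k oapp (fun l => (l == i)%:R * (-1) ^+ s + (l == j)%:R * (-1) ^+ t) a
    (unlift ord0 k).

Lemma sparse_word_lift (N : nat) (a : 'F_3) (s t : bool) (i j l : 'I_N) :
  sparse_word a s t i j 0 (lift ord0 l) =
    (l == i)%:R * (-1) ^+ s + (l == j)%:R * (-1) ^+ t.
Proof. by rewrite mxE liftK. Qed.

(** The strict order keeps the two signed entries from merging and rules out exchanging them, so the
    support outside position 0 determines the pair, and the entries then give the signs. *)
Lemma sparse_word_inj (N : nat) (a a' : 'F_3) (s s' t t' : bool)
    (i i' j j' : 'I_N) :
  (i < j)%N -> (i' < j')%N ->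
  sparse_word a s t i j = sparse_word a' s' t' i' j' ->
  (a, (s, t), (i, j)) = (a', (s', t'), (i', j')).
Proof.
move=> ij ij' eq_w.
have eq_a : a = a' by move/rowP/(_ ord0): eq_w; rewrite !mxE unlift_none.
have eq_l l := congr1 (fun w : 'rV_N.+1 => w 0 (lift ord0 l)) eq_w.
have sign0 (b : bool) : (-1) ^+ b != 0 :> 'F_3 by rewrite signr_eq0.
have ji : (j == i) = false by apply: gtn_eqF.
have ij0 : (i == j) = false by apply: ltn_eqF.
have iP : (i == i') || (i == j').
  apply: contraTT (sign0 s) => /norP[/negPf ii' /negPf ij'0].
  have := eq_l i; rewrite !sparse_word_lift eqxx ij0 ii' ij'0 mul1r !mul0r !addr0.
  by move->; rewrite eqxx.
have jP : (j == i') || (j == j').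
  apply: contraTT (sign0 t) => /norP[/negPf ji' /negPf jj'0].
  have := eq_l j; rewrite !sparse_word_lift eqxx ji ji' jj'0 mul1r !mul0r !add0r.
  by move->; rewrite eqxx.
have [ei ej] : i = i' /\ j = j'.
  case/orP: iP => /eqP ei; case/orP: jP => /eqP ej; move: ij ij'; rewrite ei ej //.
  - by rewrite ltnn.
  - by move=> /ltnW; rewrite leqNgt => /negPf->.
  - by rewrite ltnn.
have sgn_inj (b b' : bool) : (-1) ^+ b = (-1) ^+ b' :> 'F_3 -> b = b'.
  by case: b; case: b'.
have := eq_l i; rewrite !sparse_word_lift -ei -ej eqxx ij0 !mul1r !mul0r !addr0.
have := eq_l j; rewrite !sparse_word_lift -ei -ej eqxx ji !mul1r !mul0r !add0r.
by move=> /sgn_inj -> /sgn_inj ->; rewrite eq_a.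
Qed.

(* There are 12 'C(n - 1, 2) words with an arbitrary entry in position 0 and exactly
   two nonzero entries elsewhere; two of them agree modulo h. *)
Lemma low_weight_multiple (n k : nat) (h : {poly 'F_3}) :
  size h = k.+1 -> (3 ^ k < 12 * 'C(n.-1, 2))%N ->
  exists v : 'rV['F_3]_n, [/\ v != 0, h %| rVpoly v & (wt v <= 5)%N].
Proof.
case: n => [|N]; rewrite ?muln0 //=.
move=> szh ltk; have h0 : h != 0 by rewrite -size_poly_eq0 szh.
pose P := {p : 'I_N * 'I_N | (p.1 < p.2)%N}.
pose W (x : 'F_3 * (bool * bool) * P) :=
  sparse_word x.1.1 x.1.2.1 x.1.2.2 (val x.2).1 (val x.2).2.
have W_inj : injective W.
  move=> [[a [s t]] [[i j] ij]] [[a' [s' t']] [[i' j'] ij']] /=.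
  move/(sparse_word_inj ij ij') => [-> -> -> ei ej]; congr (_, _).
  by apply: val_inj; rewrite /= ei ej.
pose phi x : 'rV['F_3]_k := poly_rV (rVpoly (W x) %% h).
have cardT : #|{: 'F_3 * (bool * bool) * P}| = (12 * 'C(N, 2))%N.
  rewrite !card_prod card_F3 card_bool card_sig -card_ltn_pairs.
  by congr (_ * _)%N; rewrite cardsE.
have [/injectiveP/leq_card|/injectivePn[x [y nxy eq_xy]]] := boolP (injectiveb phi).
  by rewrite cardT card_mx card_F3 mul1n leqNgt ltk.
have szmod p : (size (p %% h)%R <= k)%N by rewrite -ltnS -szh ltn_modp.
exists (W x - W y); split.
- by rewrite subr_eq0 (inj_eq W_inj).
- move/(congr1 rVpoly): eq_xy; rewrite !poly_rV_K // => eq_mod.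
  by rewrite linearB /dvdp modpD modpN eq_mod subrr.
pose L z := lift ord0 z : 'I_N.+1.
pose s := [:: ord0; L (val x.2).1; L (val x.2).2; L (val y.2).1; L (val y.2).2].
apply: leq_trans (card_size s); apply: subset_leq_card; apply/subsetP => l.
rewrite !inE mxE [in X in _ + X]mxE; case: (unliftP ord0 l) => [z ->|-> _].
  rewrite !sparse_word_lift /L !(inj_eq lift_inj); apply: contraNT.
  by rewrite !negb_or => /and5P[_ /negPf-> /negPf-> /negPf-> /negPf->]; rewrite !mul0r !addr0 subrr.
by [].
Qed.

(** * The dual of a negacyclic code *)

(** If g h = X^n + 1, with g dividing c and h dividing the reciprocal of v, their product is a
    multiple of X^n + 1, so c and v are orthogonal. This gives one inclusion; both sides have
    3^(n-k) elements. *)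
Lemma dual_negacyclic_code (n k : nat) (h : {poly 'F_3}) :
  (0 < n)%N -> size h = k.+1 -> h %| 'X^n + 1 ->
  (forall v : 'rV['F_3]_n, h %| rVpoly v -> h %| reciprocal v) ->
  #|negacyclic_code n h| = (3 ^ k)%N /\
  dual_code (negacyclic_code n h) = [set v : 'rV['F_3]_n | h %| rVpoly v].
Proof.
move=> n0 szh hX hrec; have szX : size ('X^n + 1 : {poly 'F_3}) = n.+1.
  by rewrite -[1]polyC1 size_XnaddC.
have le_kn : (k <= n)%N.
  by rewrite -ltnS -szh -szX dvdp_leq // -size_poly_eq0 szX.
have cardC : #|negacyclic_code n h| = (3 ^ k)%N.
  rewrite (@card_words_dvdp n (n - k)) ?subKn ?leq_subr //.
  by rewrite size_divp -?size_poly_eq0 ?szh // szX subSn.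
split=> //; apply/esym/eqP; rewrite eqEcard.
rewrite (card_dual_code (linear_code_dvdp _ _) cardC) (card_words_dvdp szh) //.
rewrite leqnn andbT; apply/subsetP => v; rewrite !inE => hv.
apply/forall_inP => c; rewrite inE => gc; apply/eqP.
under eq_bigr do rewrite mulrC.
by apply: dot_eq0 => //; rewrite -(divpK hX) dvdp_mul // hrec.
Qed.

(** * Exponents of the roots of the check polynomial *)

(** Since 3^m - 1 is the order of beta, the second half represents the exponents -3^j, the
    conjugates of the inverse of beta. *)
Definition check_exponents (m : nat) : seq nat :=
  [seq 3 ^ j | j <- iota 0 m]%N ++ [seq 3 ^ m - 1 - 3 ^ j | j <- iota 0 m]%N.

(** The gap between the largest 3^j and the smallest complement 2 3^(m-1) - 1 is where the BCH zeros
    will be taken. *)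
Lemma check_exponentsP (m e : nat) :
  (1 < m)%N -> e \in check_exponents m ->
  [/\ (e < 3 ^ m - 1)%N & (e <= 3 ^ m.-1)%N || (3 ^ m - 1 - 3 ^ m.-1 <= e)%N].
Proof.
case: m => [|[|m]] // _; rewrite /check_exponents mem_cat.
have le3 j : j \in iota 0 m.+2 -> (0 < 3 ^ j <= 3 ^ m.+1)%N.
  by rewrite mem_iota ltnS => le_j; rewrite expn_gt0 leq_pexp2l.
have Q0 : (0 < 3 ^ m)%N by rewrite expn_gt0.
by case/orP => /mapP[j /le3 + ->]; rewrite !expnS; split; lia.
Qed.

Lemma check_exponents_uniq (m : nat) : (1 < m)%N -> uniq (check_exponents m).
Proof.
case: m => [|[|m]] // _.
have le3 j : j \in iota 0 m.+2 -> (0 < 3 ^ j <= 3 ^ m.+1)%N.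
  by rewrite mem_iota ltnS => le_j; rewrite expn_gt0 leq_pexp2l.
have Q0 : (0 < 3 ^ m)%N by rewrite expn_gt0.
rewrite cat_uniq !map_inj_in_uniq ?iota_uniq // ?andbT; last 2 first.
- move=> i j /le3 + /le3 +; rewrite !expnS => iP jP eq_ij.
  by apply: (@expnI 3) => //; lia.
- by move=> i j _ _ /expnI; apply.
(* A clash of the two halves would give 3^i + 3^j = 3^m - 1, but the left side is at most two thirds
   of 3^m. *)
apply/hasPn => _ /mapP[i /le3 + ->]; rewrite expnS => iP.
apply/mapP => -[j /le3]; rewrite !expnS => jP; lia.
Qed.

(** * The check polynomial, its roots, and the weights in the code and its dual *)

Section CheckPolynomial.

Variables (m n : nat) (F : fieldType) (f : {rmorphism 'F_3 -> F}) (beta : F).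
Variables M1 M2 h : {poly 'F_3}.
Hypotheses (hm : (3 <= m)%N) (nE : (2 * n)%N = (3 ^ m - 1)%N).
Hypothesis prim_beta : (2 * n)%N.-primitive_root beta.
Hypothesis minM1 : is_minpoly f beta M1.
Hypothesis minM2 : is_minpoly f (beta ^+ (2 * n - 1)) M2.
Hypothesis lcm_h : is_lcm M1 M2 h.

Let Q := (3 ^ m.-1)%N.

Let m_gt0 : (0 < m)%N. Proof. by lia. Qed.

Let expmE : (3 ^ m = 3 * Q)%N. Proof. by rewrite /Q -expnS prednK. Qed.

Let Q_ge9 : (9 <= Q)%N.
Proof. by rewrite /Q (@leq_pexp2l 3 2) //; lia. Qed.

Let odd_Q : odd Q. Proof. by rewrite /Q oddX orbT. Qed.

Let n_gt0 : (0 < n)%N. Proof. by lia. Qed.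

Let beta_neq0 : beta != 0.
Proof.
have := prim_expr_order prim_beta; apply: contra_eq_neq => ->.
by rewrite expr0n; case: n n_gt0 => // k _; rewrite eq_sym oner_eq0.
Qed.

Let beta_n : beta ^+ n = -1.
Proof.
have /eqP : (beta ^+ n) ^+ 2 = 1 by rewrite -exprM mulnC prim_expr_order.
rewrite sqrf_eq1 => /orP[|/eqP //].
rewrite -(expr0 beta) (eq_prim_root_expr prim_beta) mod0n modn_small; lia.
Qed.

Let betaV : beta ^+ (2 * n - 1) = beta^-1.
Proof.
apply: (mulfI beta_neq0); rewrite -exprS mulfV // -(prim_expr_order prim_beta).
by congr (_ ^+ _); lia.
Qed.

Let expn_beta (s : nat) : odd s -> (beta ^+ s) ^+ n = -1.
Proof. by move=> os; rewrite exprAC beta_n -signr_odd os. Qed.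

Let root_Xn1 (x : F) : x ^+ n = -1 -> root (map_poly f ('X^n + 1)) x.
Proof.
by move=> xn; rewrite rmorphD rmorph1 /= map_polyXn /root !hornerE xn addNr.
Qed.

(** The universal property of the lcm reduces divisibility by [h] to evaluation at two mutually
    inverse points. *)
Lemma check_poly_dvdp (q : {poly 'F_3}) :
  (h %| q) = root (map_poly f q) beta && root (map_poly f q) beta^-1.
Proof.
have [_ M1h M2h minh] := lcm_h.
rewrite -betaV -(dvdp_minpoly q minM1) -(dvdp_minpoly q minM2).
apply/idP/andP => [hq|[M1q M2q]]; last exact: minh.
by split; apply: dvdp_trans hq.
Qed.

Lemma check_poly_dvdp_Xn1 : h %| 'X^n + 1.
Proof.
rewrite check_poly_dvdp -betaV !root_Xn1 // expn_beta //.
by rewrite oddB ?muln_gt0 // mul2n odd_double.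
Qed.

Let h_neq0 : h != 0.
Proof. by have [monh _ _ _] := lcm_h; apply: monic_neq0. Qed.

Let check_roots : seq F := [seq beta ^+ e | e <- check_exponents m].

Let check_roots_all : all (root (map_poly f h)) check_roots.
Proof.
have := dvdpp h; rewrite check_poly_dvdp => /andP[h1 h2].
apply/allP => _ /mapP[e + ->]; rewrite mem_cat => /orP[] /mapP[j + ->].
  by move=> _; apply: root_map_F3_exp.
rewrite mem_iota => jm.
have -> : beta ^+ (3 ^ m - 1 - 3 ^ j) = beta^-1 ^+ (3 ^ j).
  have lej : (3 ^ j <= Q)%N by rewrite leq_pexp2l //; lia.
  rewrite exprVn; apply: (mulfI (expf_neq0 (3 ^ j) beta_neq0)).
  rewrite -exprD mulfV ?expf_neq0 // -(prim_expr_order prim_beta).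
  by congr (_ ^+ _); lia.
exact: root_map_F3_exp.
Qed.

Let beta_expr_inj (s e : nat) :
  (s < 2 * n)%N -> (e < 2 * n)%N -> beta ^+ s = beta ^+ e -> s = e.
Proof.
move=> ls le /eqP; rewrite (eq_prim_root_expr prim_beta) => /eqP.
by rewrite !modn_small.
Qed.

Let exponents_lt e : e \in check_exponents m -> (e < 2 * n)%N.
Proof. by move/check_exponentsP; rewrite nE => /(_ (ltnW hm))[]. Qed.

Let check_roots_uniq : uniq check_roots.
Proof.
rewrite map_inj_in_uniq ?check_exponents_uniq //; first exact: ltnW.
by move=> s e /exponents_lt ls /exponents_lt le /(beta_expr_inj ls le).
Qed.

Let size_check_roots : size check_roots = (2 * m)%N.
Proof. by rewrite size_map size_cat !size_map size_iota addnn mul2n. Qed.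

(** The 2m distinct roots bound the degree from below. From above, beta and its inverse are fixed by
    x -> x^(3^m), so each minimal polynomial has degree at most [m], and [h] divides their
    product. *)
Lemma size_check_poly : size h = (2 * m).+1.
Proof.
apply/eqP; rewrite eqn_leq; apply/andP; split; last first.
  rewrite -size_check_roots -(size_map_poly f) max_poly_roots //.
  by rewrite map_poly_eq0.
have [[monM1 _ _] [monM2 _ _]] := (minM1, minM2).
have [_ _ _ minh] := lcm_h.
have le1 : (size M1 <= m.+1)%N.
  apply: (minpoly_size_le m_gt0 _ minM1).
  have -> : (3 ^ m)%N = (2 * n).+1 by lia.
  by rewrite exprS prim_expr_order // mulr1.
have le2 : (size M2 <= m.+1)%N.
  apply: (minpoly_size_le m_gt0 _ minM2); rewrite betaV exprVn.
  have -> : (3 ^ m)%N = (2 * n).+1 by lia.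
  by rewrite exprS prim_expr_order // mulr1.
apply: leq_trans (dvdp_leq _ (minh (M1 * M2) (dvdp_mulr _ _) (dvdp_mull _ _))) _ => //.
  by rewrite mulf_neq0 // monic_neq0.
rewrite size_mul ?monic_neq0 //; move: (leq_add le1 le2).
by rewrite addnS addSn addnn -mul2n; case: (_ + _)%N.
Qed.

(** The listed roots already exhaust the degree 2m of [h]. *)
Lemma check_poly_root (s : nat) :
  (s < 2 * n)%N -> s \notin check_exponents m ->
  ~~ root (map_poly f h) (beta ^+ s).
Proof.
move=> ls nse; apply/negP => hs.
have := @max_poly_roots _ (map_poly f h) (beta ^+ s :: check_roots).
rewrite map_poly_eq0 size_map_poly size_check_poly /= size_check_roots ltnn.
rewrite hs check_roots_all check_roots_uniq andbT => /(_ h_neq0 isT) H.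
suff: false by []; apply: H; rewrite andbT; apply: contra nse => /mapP[e eE].
by move/(beta_expr_inj ls (exponents_lt eE)) => ->.
Qed.

Let sqr_beta_inj : injective (fun i : 'I_n => (beta ^+ 2) ^+ i).
Proof.
move=> i j /=; rewrite -!exprM => eq_ij; apply: val_inj.
have ltn2 (k : 'I_n) : (2 * k < 2 * n)%N by rewrite ltn_pmul2l.
by move/(beta_expr_inj (ltn2 i) (ltn2 j)): eq_ij => /eqP; rewrite eqn_pmul2l // => /eqP.
Qed.

Lemma negacyclic_wt_ge (c : 'rV['F_3]_n) :
  c \in negacyclic_code n h -> c != 0 -> ((3 ^ (m - 1) - 1) %/ 2 <= wt c)%N.
Proof.
rewrite inE => /dvdpP[w cE] c0; have eqQ : (3 ^ (m - 1))%N = Q by rewrite subn1.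
(* As [Q] is odd, the odd exponents strictly between Q and 2Q - 1 are Q + 2, Q + 4, ..., 2Q - 3,
   which are (Q - 1)/2 - 1 in number. *)
have := @BCH_bound F f n ((Q - 1) %/ 2 - 1) c (beta ^+ (Q + 2)) (beta ^+ 2).
rewrite expf_neq0 // => /(_ isT sqr_beta_inj c0) bch.
rewrite eqQ; suff: ((Q - 1) %/ 2 - 1 < wt c)%N by lia.
apply: bch => k ltk; rewrite -exprM -exprD; set s := (Q + 2 + 2 * k)%N.
have odd_s : odd s by rewrite /s mul2n oddD odd_double oddD odd_Q.
have [ls1 ls2] : (Q < s)%N /\ (s < 2 * Q - 1)%N by rewrite /s; lia.
(* An odd power of beta is a root of X^n + 1; not being a root of [h], it is a root of the
   generator, hence of [c]. *)
have : root (map_poly f ('X^n + 1)) (beta ^+ s) by rewrite root_Xn1 ?expn_beta.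
rewrite -(divpK check_poly_dvdp_Xn1) rmorphM rootM.
rewrite (negPf (check_poly_root _ _)) ?orbF; first last.
- by apply/negP => /(check_exponentsP (ltnW hm))[_]; rewrite expmE -/Q; lia.
- by rewrite nE expmE; lia.
by move=> gs; rewrite cE rmorphM rootM gs orbT.
Qed.

Lemma dual_wt_ge5 (v : 'rV['F_3]_n) :
  h %| rVpoly v -> v != 0 -> (5 <= wt v)%N.
Proof.
by rewrite check_poly_dvdp => /andP[v1 v2] v0; apply: (wt_ge5 beta_neq0) v1 v2.
Qed.

Lemma dual_wt_eq5 :
  exists v : 'rV['F_3]_n, [/\ h %| rVpoly v, v != 0 & wt v = 5%N].
Proof.
have [|v [v0 hv wv]] := @low_weight_multiple n _ _ size_check_poly.
  (* The count requires (2n + 1)^2 < 6 (n - 1)(n - 2), which holds for n >= 13, the value of [n] at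
     m = 3. *)
  have := bin_ffact n.-1 2; rewrite ffactnS ffactn1 => binE.
  have -> : (3 ^ (2 * m) = (2 * n + 1) ^ 2)%N by rewrite mulnC expnM; congr (_ ^ _)%N; lia.
  have n13 : (13 <= n)%N by lia.
  move: binE; have -> : (2`! = 2)%N by [].
  by move: n13; case: (n) => // k; rewrite /= => n13 binE; nia.
by exists v; split=> //; apply/eqP; rewrite eqn_leq wv dual_wt_ge5.
Qed.

(** Up to the factor x^n, passing to the reciprocal exchanges the values at beta and at its
    inverse. *)
Lemma check_poly_dvdp_reciprocal (v : 'rV['F_3]_n) :
  h %| rVpoly v -> h %| reciprocal v.
Proof.
rewrite !check_poly_dvdp /root => /andP[v1 v2].
by rewrite !horner_reciprocal ?invr_eq0 // invrK !mulf_eq0 v1 v2 !orbT.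
Qed.

End CheckPolynomial.

(** * Parameters of the code and of its dual *)

Theorem theorem31 (m : nat) (hm : (3 <= m)%N)
    (F : fieldType) (f : {rmorphism 'F_3 -> F}) (beta : F)
    (M1 M2 h : {poly 'F_3}) :
  let n := ((3 ^ m - 1) %/ 2)%N in
  (2 * n)%N.-primitive_root beta ->
  is_minpoly f beta M1 ->
  is_minpoly f (beta ^+ (2 * n - 1)) M2 ->
  is_lcm M1 M2 h ->
  let C := negacyclic_code n h in
  [/\ code_dim C = (2 * m)%N,
      (exists d, is_min_dist C d /\ ((3 ^ (m - 1) - 1) %/ 2 <= d)%N),
      code_dim (dual_code C) = (n - 2 * m)%N &
      is_min_dist (dual_code C) 5].
Proof.
move=> n prim_beta minM1 minM2 lcm_h C.
have nE : (2 * n)%N = (3 ^ m - 1)%N.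
  (* Oddness of 3^m makes the halving in [n] exact. *)
  have : odd (3 ^ m) by rewrite oddX orbT.
  by rewrite /n; lia.
have n_gt0 : (0 < n)%N by have := prim_order_gt0 prim_beta; rewrite muln_gt0.
have [cardC dualC] := dual_negacyclic_code n_gt0
  (size_check_poly hm nE prim_beta minM1 minM2 lcm_h)
  (check_poly_dvdp_Xn1 hm nE prim_beta minM1 minM2 lcm_h)
  (check_poly_dvdp_reciprocal hm nE prim_beta minM1 minM2 lcm_h).
have linC : linear_code C := linear_code_dvdp _ _.
split.
- exact: code_dim_card.
- apply: min_dist_exists (negacyclic_wt_ge hm nE prim_beta minM1 minM2 lcm_h).
  by rewrite cardC (@ltn_exp2l 3 0) //; lia.
- exact: code_dim_card (linear_code_dual _) (card_dual_code linC cardC).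
rewrite dualC; split=> [|v].
  have [v [hv v0 wv]] := dual_wt_eq5 hm nE prim_beta minM1 minM2 lcm_h.
  by exists v; rewrite ?inE.
rewrite inE; exact: (dual_wt_ge5 hm nE prim_beta minM1 minM2 lcm_h).
Qed.
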